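(* Let $\mathcal T$ be a set of tile designs, with $t_{\mathrm{id}}$ tiles, for the tetrakis hexahedron with symmetry group the full tetrahedral group $T_d$ (order $24$). Then the number of ways of tiling the faces of the tetrakis hexahedron up to full tetrahedral symmetry $T_d$ is $$\frac{1}{24}\left(t_{\mathrm{id}}^{24}+3t_{\mathrm{id}}^{12}+8t_{\mathrm{id}}^8+6t_{\mathrm{id}}^{12}+6t_{\mathrm{id}}^6\right)=\frac{1}{24}\left(t_{\mathrm{id}}^{24}+9t_{\mathrm{id}}^{12}+8t_{\mathrm{id}}^8+6t_{\mathrm{id}}^6\right).$$
   Context: Tilings. Let $P$ be a polyhedron with set of faces $\mathcal F$ and let $\mathcal A$ be a group of isometries of $P$, acting on $\mathcal F$. A set of tile designs is a finite set $\mathcal T$ together with a group action of $\mathcal A$ on $\mathcal T\times\mathcal F$ lying over the action on $\mathcal F$ (so $A\cdot(T,F)=(T',A\cdot F)$ for some $T'\in\mathcal T$); write $t_{\mathrm{id}}=|\mathcal T|$. A tiling is a map $\tau:\mathcal F\to\mathcal T$; $\mathcal A$ acts on tilings by moving graphs: $A\cdot\tau$ is the tiling with $((A\cdot\tau)(A\cdot F),A\cdot F)=A\cdot(\tau(F),F)$ for all $F$. The number of ways of tiling up to $\mathcal A$ is the number of $\mathcal A$-orbits on the set of tilings. Polyhedron and group. The tetrakis hexahedron (dual of the truncated octahedron) is the convex polyhedron with $14$ vertices and $24$ isosceles triangular faces that is the convex hull of the orbits of $(1,0,0)$ and $\frac23(1,1,1)$ under the group $O_h$ of all $3\times3$ signed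 permutation matrices. Here $\mathcal A=T_d$ is the subgroup of order $24$ of $O_h$ generated by $R_0=\begin{pmatrix}0&1&0\\1&0&0\\0&0&1\end{pmatrix}$, $R_1=\begin{pmatrix}1&0&0\\0&0&1\\0&1&0\end{pmatrix}$, $R_2=\begin{pmatrix}0&-1&0\\-1&0&0\\0&0&1\end{pmatrix}$. *)

(* Defs.v *)
From HB Require Import structures.
From mathcomp Require Import all_boot all_order all_fingroup all_algebra.
From mathcomp Require Import boolp classical_sets functions cardinality.
From mathcomp Require Import reals convex.

Set Implicit Arguments.
Unset Strict Implicit.
Unset Printing Implicit Defensive.

Import Order.TTheory GRing.Theory Num.Theory.

Local Open Scope classical_set_scope.
Local Open Scope ring_scope.

Section Polyhedra.
Variable R : realType.

Definition convex_hull (X : set 'cV[R]_3) : set 'cV[R]_3 :=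
  smallest (@convex_set R 'cV[R]_3) X.

Definition aff_indep3 (x y z : 'cV[R]_3) : Prop :=
  \rank (row_mx (y - x) (z - x)) = 2%N.

(* The two-dimensional faces, as subsets of space: the intersections of P with
   a supporting plane that are not contained in a line. *)
Definition faces (P : set 'cV[R]_3) : set (set 'cV[R]_3) :=
  [set F | exists (u : 'rV[R]_3) (c : R),
    [/\ u != 0,
        forall x, P x -> (u *m x) 0 0 <= c,
        F = [set x | P x /\ (u *m x) 0 0 = c] &
        exists x y z, [/\ F x, F y, F z & aff_indep3 x y z]]].

Definition face (P : set 'cV[R]_3) : Type := set_type (faces P).

Definition mximage (A : 'M[R]_3) (X : set 'cV[R]_3) : set 'cV[R]_3 :=
  [set A *m x | x in X].

(* For invertible gens this is the subgroup of GL_3 that they generate. *)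
Definition generated (gens : set 'M[R]_3) : set 'M[R]_3 :=
  smallest [set H : set 'M[R]_3 | H 1%:M /\
    forall A B, H A -> H B -> H (A *m invmx B)] gens.

End Polyhedra.

(* The action of G on tile * face P is given by a function on all matrices, of which
   only the values on G are constrained or used. *)
Record tile_designs (R : realType) (G : set 'M[R]_3) (P : set 'cV[R]_3) :=
  TileDesigns {
    tile : finType;
    tile_act : 'M[R]_3 -> tile * face P -> tile * face P;
    tile_act1 : forall d, tile_act 1%:M d = d;
    tile_actM : forall A B, G A -> G B ->
      forall d, tile_act (A *m B) d = tile_act A (tile_act B d);
    tile_act_face : forall A, G A ->
      forall d, set_val (tile_act A d).2 = mximage A (set_val d.2)
  }.

Section Tilings.
Variables (R : realType) (G : set 'M[R]_3) (P : set 'cV[R]_3).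
Variable T : tile_designs G P.

Definition tiling : Type := face P -> tile T.

Definition tiling_graph (tau : tiling) : set (tile T * face P) :=
  [set (tau F, F) | F in [set: face P]].

Definition tiling_orbit (tau : tiling) : set tiling :=
  [set tau' | exists2 A, G A &
    tiling_graph tau' = [set tile_act A d | d in tiling_graph tau]].

Definition tiling_orbits : set (set tiling) :=
  [set tiling_orbit tau | tau in [set: tiling]].

End Tilings.

Arguments tiling_orbits {R G P} T.

Section TetrakisHexahedron.
Variable R : realType.

Definition mx3 (rows : seq (seq R)) : 'M[R]_3 :=
  \matrix_(i, j) (nth [::] rows i)`_j.

Definition vec3 (x y z : R) : 'cV[R]_3 := \col_i [:: x; y; z]`_i.

Definition Oh : set 'M[R]_3 :=
  [set A | exists (s : 'S_3) (e : 'I_3 -> bool),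
    A = diag_mx (\row_i (-1) ^+ e i) *m perm_mx s].

Definition R0 : 'M[R]_3 := mx3 [:: [:: 0; 1; 0]; [:: 1; 0; 0]; [:: 0; 0; 1]].

Definition R1 : 'M[R]_3 := mx3 [:: [:: 1; 0; 0]; [:: 0; 0; 1]; [:: 0; 1; 0]].

Definition R2 : 'M[R]_3 :=
  mx3 [:: [:: 0; -1; 0]; [:: -1; 0; 0]; [:: 0; 0; 1]].

Definition Td : set 'M[R]_3 := generated [set R0; R1; R2].

Definition tetrakis_hexahedron : set 'cV[R]_3 :=
  convex_hull ([set A *m vec3 1 0 0 | A in Oh] `|`
               [set A *m ((2 / 3) *: vec3 1 1 1) | A in Oh]).

End TetrakisHexahedron.

Arguments Oh : clear implicits.
Arguments Td : clear implicits.
Arguments tetrakis_hexahedron : clear implicits.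

(* Main.v *)
Require Import Defs.
From HB Require Import structures.
From mathcomp Require Import all_boot all_order all_fingroup all_algebra.
From mathcomp Require Import boolp classical_sets functions cardinality.
From mathcomp Require Import reals convex.
From mathcomp Require Import cyclic interval_inference ring lra.

Set Implicit Arguments.
Unset Strict Implicit.
Unset Printing Implicit Defensive.

Import Order.TTheory GRing.Theory Num.Theory.

Local Open Scope classical_set_scope.
Local Open Scope ring_scope.

(** The symmetry group acts freely and transitively on the 24 faces, so tilings
    of the faces behave like colourings of the group S_4 by the tiles, permuted
    by translation.  A group element of order d then has 24 / d cycles, all of
    length d, on the faces; going once round a cycle is the action of the
    identity, so a fixed tiling is a free choice of one tile for each cycle, and
    there are t ^ (24 / d) of them, however the group permutes the designs.
    Burnside's lemma and the orders of the elements of S_4 (one of order 1,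
    nine of order 2, eight of order 3, six of order 4) give the formula.

    The geometry is expressed through the four vertices tetra i of a regular
    tetrahedron inscribed in the cube.  Their sum is zero and they form a
    tight frame, so a permutation s of the four vertices extends to a unique
    linear map tetra_rep s, and Td is the set of these 24 maps (TdE).  In the
    coordinates height x i, the inner products of x with the vertices, the
    tetrakis hexahedron is dual to a permutohedron: its facet normals are the
    24 permutations of the vector weight = (3, 1, -1, -3) / 2, whose entries
    are distinct, and this is why the action on the faces is free.

    The polyhedron is the intersection of the half-spaces of these normals
    (hullP): sort the heights of a point in decreasing order; the sorted heights
    lie in a simplicial cone spanned by three vertices of one facet, and the
    inequality of that facet bounds the sum of the coefficients by 1.  Every
    face is then one of the 24 facets (facesE): the centroid of three affinely
    independent points of a face lies on some facet, for otherwise it could be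
    moved further in the direction of the supporting functional; the three
    points then lie on that facet as well, and so the two planes coincide.

    Finally a tiling is unrolled along the group: its graph is the set of the
    images under s of designs (f s, base face), for exactly one function f from
    S_4 to the tiles, and the action on tilings becomes the translation of
    f (act_unrolled). *)

(** * Colourings of a finite group up to translation *)

Section RegularColourings.
Variables (gT : finGroupType) (X : finType).
Local Open Scope group_scope.

Definition translate (f : {ffun gT -> X}) (a : gT) : {ffun gT -> X} :=
  [ffun h => f (h * a^-1)].

Lemma translate_is_action : is_action [set: gT]%SET translate.
Proof.
apply: is_total_action => [f | f a b]; apply/ffunP => h; rewrite !ffunE.
  by rewrite invg1 mulg1.
by rewrite invMg mulgA.
Qed.

Canonical translation := Action translate_is_action.

(** A colouring is fixed by a when it is constant on the left cosets of the
    cyclic group generated by a. *)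
Lemma card_fix_translation (a : gT) :
  #|'Fix_translation[a]| = (#|X| ^ (#|gT| %/ #[a]))%N.
Proof.
pose L := lcosets <[a]> [set: gT]%SET.
have memL h : h *: <[a]> \in L by apply/lcosetsP; exists h.
pose spread (g : {ffun {C | C \in L} -> X}) : {ffun gT -> X} :=
  [ffun h => g (exist _ (h *: <[a]>) (memL h))].
have spread_inj : injective spread.
  move=> g1 g2 /ffunP eg; apply/ffunP => -[C LC].
  have [h _ defC] := lcosetsP LC; move/(_ h): eg; rewrite !ffunE.
  by rewrite (_ : exist _ _ _ = exist _ C LC) //; apply: val_inj.
have -> : 'Fix_translation[a] = spread @: [set: {ffun {C | C \in L} -> X}]%SET.
  apply/setP => f; apply/afix1P/imsetP => [fa | [g _ ->]]; last first.
    apply/ffunP => h; rewrite !ffunE; congr (g _); apply: val_inj => /=.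
    by rewrite lcosetM (lcoset_id (groupVr (cycle_id a))).
  have f_const h k : k \in h *: <[a]> -> f k = f h.
    case/lcosetP => _ /cycleP[n ->] ->.
    elim: n => [|n IHn]; first by rewrite mulg1.
    by rewrite -IHn -{1}fa ffunE expgSr mulgA mulgK.
  exists [ffun C => f (repr (val C))] => //.
  apply/ffunP => h; rewrite !ffunE; apply/esym/f_const.
  by apply: mem_repr (lcoset_refl _ h).
rewrite card_imset // cardsT card_ffun card_sig; congr (_ ^ _)%N.
rewrite (_ : #|[pred C | C \in L]| = #|L|); last exact: eq_card.
by rewrite card_lcosets -divgS /= ?cardsT //; apply: finset.subsetT.
Qed.

Lemma card_orbits_translation :
  (#|orbit translation [set: gT]%SET @: [set: {ffun gT -> X}]%SET| * #|gT|)%N =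
    (\sum_(a : gT) #|X| ^ (#|gT| %/ #[a]))%N.
Proof.
have trT : [acts [set: gT]%SET, on [set: {ffun gT -> X}]%SET | translation].
  by apply/actsP => a _ f; rewrite !inE.
rewrite -[#|gT|]cardsT -(Frobenius_Cauchy trT).
apply: eq_big => [a | a _]; first by rewrite inE.
by rewrite finset.setTI card_fix_translation cardsT.
Qed.

End RegularColourings.

Lemma card_eq_finset (I : finType) (A : {set I}) : ([set` A] #= `I_#|A|)%card.
Proof.
have -> : [set` A] = [set enum_val i | i in [set: 'I_#|A|]].
  apply/seteqP; split=> [x xA|_ [i _ <-]]; last exact: enum_valP.
  by exists (enum_rank_in xA x); rewrite ?enum_rankK_in.
apply: card_eq_trans (inj_card_eq _) _ => [i j _ _|]; first exact: enum_val_inj.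
by rewrite card_eq_sym card_II.
Qed.

(** * Orders of the elements of S_4 *)

Section OrdersInS4.
Local Open Scope nat_scope.
Variable n : nat.

(** Permutations do not compute, but lists of their values do: orders in S_4 are
    counted by enumerating the permutations of the list 0, 1, 2, 3. *)
Definition one_line (s : 'S_n) : seq nat := [seq val (s i) | i <- enum 'I_n].

Lemma nth_one_line (s : 'S_n) (i : 'I_n) : nth 0 (one_line s) i = s i.
Proof. by rewrite (nth_map i) ?nth_ord_enum // size_enum_ord. Qed.

Lemma one_line_inj : injective one_line.
Proof.
move=> s t est; apply/permP => i; apply: val_inj.
by rewrite -[LHS]nth_one_line -[RHS]nth_one_line est.
Qed.

Lemma perm_one_line :
  perm_eq [seq one_line s | s <- enum 'S_n] (permutations (iota 0 n)).
Proof.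
have one_lineP s : perm_eq (one_line s) (iota 0 n).
  rewrite -val_enum_ord /one_line map_comp perm_map //.
  apply: uniq_perm; rewrite ?(map_inj_uniq (@perm_inj _ s)) ?enum_uniq //.
  move=> i; rewrite mem_enum; apply/mapP; exists (s^-1%g i).
    by rewrite mem_enum.
  by rewrite permKV.
have Us : uniq [seq one_line s | s <- enum 'S_n].
  by rewrite (map_inj_uniq one_line_inj) enum_uniq.
apply: uniq_perm; rewrite ?permutations_uniq //.
have [|| _ //] := uniq_min_size (s2 := permutations (iota 0 n)) Us.
  move=> _ /mapP[s _ ->].
  by rewrite mem_permutations.
by rewrite size_permutations ?iota_uniq // size_iota size_map -cardE card_Sn.
Qed.

Definition list_power (l : seq nat) (k : nat) : seq nat :=
  iter k (map (nth 0 l)) (iota 0 n).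

Lemma one_lineX (s : 'S_n) k : one_line (s ^+ k) = list_power (one_line s) k.
Proof.
elim: k => [|k IHk] /=.
  rewrite /list_power /= -val_enum_ord; apply: eq_map => i.
  by rewrite expg0 perm1.
rewrite -[RHS]/(map _ (list_power _ k)) -IHk -map_comp; apply: eq_map => i /=.
by rewrite nth_one_line expgSr permM.
Qed.

(** The search stops at exponent n, which suffices for n = 4 but not for all n:
    S_5 has elements of order 6. *)
Definition list_order (l : seq nat) : nat :=
  (find (fun k => list_power l k.+1 == iota 0 n) (iota 0 n)).+1.

End OrdersInS4.

Lemma order_one_line4 (s : 'S_4) : #[s]%g = list_order 4 (one_line s).
Proof.
have idP k : (list_power 4 (one_line s) k == iota 0 4) = (s ^+ k == 1)%g.
  rewrite -one_lineX -[iota 0 4]/(list_power 4 (one_line s) 0) -one_lineX expg0.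
  by rewrite (inj_eq (@one_line_inj 4)).
have : one_line s \in permutations (iota 0 4).
  by rewrite -(perm_mem (perm_one_line 4)) map_f ?mem_enum.
(* Every permutation of four points has order at most 4. *)
have chk : all (fun l => has (fun k => list_power 4 l k.+1 == iota 0 4) (iota 0 4))
  (permutations (iota 0 4)) by vm_compute.
move/(allP chk); set p := (fun k => _) => hp.
have lt4 : (find p (iota 0 4) < 4)%N.
  by rewrite -[X in (_ < X)%N](size_iota 0 4) -has_find.
apply/eqP; rewrite eqn_leq /list_order -/p; apply/andP; split.
  apply: dvdn_leq => //; rewrite order_dvdn -idP.
  by have := nth_find 0 hp; rewrite nth_iota.
rewrite ltnNge; apply/negP => le.
have lt : (#[s]%g.-1 < find p (iota 0 4))%N by rewrite prednK ?order_gt0.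
have := before_find 0 lt.
by rewrite nth_iota ?(ltn_trans lt lt4) // /p add0n prednK // idP expg_order eqxx.
Qed.

(** The exponents are the numbers of cycles on a regular orbit: one element of
    order 1, nine of order 2, eight of order 3, six of order 4. *)
Lemma sum_orders_S4 (x : nat) :
  (\sum_(s : 'S_4) x ^ (24 %/ #[s]%g) =
    x ^ 24 + 9 * x ^ 12 + 8 * x ^ 8 + 6 * x ^ 6)%N.
Proof.
transitivity (\sum_(k <- [seq (24 %/ list_order 4 l)%N | l <- permutations (iota 0 4)])
   x ^ k)%N.
  rewrite big_map -(perm_big _ (perm_one_line 4)) big_map big_enum /=.
  by apply: eq_bigr => s _; rewrite order_one_line4.
set ks := [seq _ | _ <- _].
have -> : ks = ltac:(let v := eval vm_compute in
  [seq (24 %/ list_order 4 l)%N | l <- permutations (iota 0 4)] in exact v).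
  by vm_compute.
by rewrite !big_cons big_nil; ring.
Qed.

(** * The tetrahedral representation of S_4 *)

Section Geometry.
Variable R : realType.
Implicit Types (x : 'cV[R]_3) (s r : 'S_4).

(** Vertex 0 is (1, 1, 1); vertex k + 1 is the one whose only positive entry is
    the entry k. *)
Definition tetra (i : 'I_4) : 'cV[R]_3 :=
  \col_k (if (i == 0%N :> nat) || (i == k.+1 :> nat) then 1 else -1).

Definition height x (i : 'I_4) : R := ((tetra i)^T *m x) 0 0.

(** The normal of the facet with vertices (1, 0, 0), 2/3 (1, 1, 1) and
    2/3 (1, 1, -1), scaled to take the value 1 on it. *)
Definition base_normal : 'rV[R]_3 := \row_k [:: 1; 1 / 2; 0]`_k.

(** The values of base_normal at the vertices of the tetrahedron; they are distinct,
    so that only the identity of Td fixes base_normal. *)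
Definition weight (i : 'I_4) : R := [:: 3 / 2; 1 / 2; - (1 / 2); - (3 / 2)]`_i.

(** The frame operator of the vertices, twisted by s: as the frame is tight with sum
    zero, this map sends tetra i to tetra (s i). *)
Definition tetra_rep s : 'M[R]_3 := 4^-1 *: \sum_i tetra (s i) *m (tetra i)^T.

Definition facet_normal s : 'rV[R]_3 := base_normal *m tetra_rep s^-1.

Lemma ord3_cases (k : 'I_3) :
  k = ord0 \/ k = lift ord0 ord0 \/ k = lift ord0 (lift ord0 ord0).
Proof.
by case: k => [[|[|[|//]]] ?]; [left|right; left|right; right]; apply: val_inj.
Qed.

Lemma sum_tetra : \sum_i tetra i = 0.
Proof.
apply/matrixP => k j; rewrite !big_ord_recl big_ord0 !mxE.
by case: k => [[|[|[|//]]] ?] /=; ring.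
Qed.

Lemma height_tetra i j : height (tetra j) i = 4 * (i == j)%:R - 1.
Proof.
rewrite /height !mxE !big_ord_recl big_ord0 !mxE.
case: i j => [[|[|[|[|//]]]] ?] [[|[|[|[|//]]]] ?] /=; ring.
Qed.

(** The vertices form a tight frame: the sum of the rank-one matrices
    tetra i (tetra i)^T is 4 times the identity. *)
Lemma tetra_frame x : x = 4^-1 *: \sum_i height x i *: tetra i.
Proof.
apply/matrixP => k j; rewrite (ord1 j) !big_ord_recl big_ord0 /height !mxE.
rewrite !big_ord_recl !big_ord0 !mxE.
by have [->|[->|->]] := ord3_cases k; rewrite /=; field.
Qed.

Lemma base_normal_tetra i : (base_normal *m tetra i) 0 0 = weight i.
Proof.
rewrite !mxE !big_ord_recl big_ord0 !mxE /weight.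
by case: i => [[|[|[|[|//]]]] ?] /=; field.
Qed.

Lemma eq_on_tetra m (A B : 'M[R]_(m, 3)) :
  (forall i, A *m tetra i = B *m tetra i) -> A = B.
Proof.
move=> eAB; apply/matrixP => k j.
suff /matrixP/(_ k 0) : col j A = col j B by rewrite !mxE.
rewrite !colE (tetra_frame (delta_mx j 0)) -!scalemxAr !mulmx_sumr.
by congr (_ *: _); apply: eq_bigr => i _; rewrite -!scalemxAr eAB.
Qed.

(** The Gram matrix of the vertices is 4 I - J, where the all-ones matrix J
    contributes nothing because the vertices sum to zero. *)
Lemma rep_tetra s i : tetra_rep s *m tetra i = tetra (s i).
Proof.
rewrite /tetra_rep -scalemxAl mulmx_suml.
have term j : tetra (s j) *m (tetra j)^T *m tetra i
    = (4 * (j == i)%:R) *: tetra (s j) - tetra (s j).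
  rewrite -mulmxA [(tetra j)^T *m _]mx11_scalar -/(height _ _) height_tetra.
  by rewrite mul_mx_scalar scalerBl scale1r.
rewrite (eq_bigr _ (fun j _ => term j)) sumrB.
rewrite [X in _ - X](_ : _ = 0); last first.
  by rewrite -[RHS]sum_tetra [RHS](reindex_inj (@perm_inj _ s)).
rewrite subr0 (bigD1 i) //= eqxx big1 => [|j /negPf->]; last by rewrite mulr0 scale0r.
by rewrite mulr1 addr0 scalerA mulVf ?pnatr_eq0 // scale1r.
Qed.

Lemma rep1 : tetra_rep 1%g = 1%:M.
Proof. by apply: eq_on_tetra => i; rewrite rep_tetra perm1 mul1mx. Qed.

(** The order is reversed because permutations are composed from left to right. *)
Lemma repM s r : tetra_rep s *m tetra_rep r = tetra_rep (r * s)%g.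
Proof. by apply: eq_on_tetra => i; rewrite -mulmxA !rep_tetra permM. Qed.

Lemma repKV s : tetra_rep s *m tetra_rep s^-1 = 1%:M.
Proof. by rewrite repM mulVg rep1. Qed.

Lemma rep_unit s : tetra_rep s \in unitmx.
Proof. by case/mulmx1_unit: (repKV s). Qed.

Lemma invmx_rep s : invmx (tetra_rep s) = tetra_rep s^-1.
Proof. by rewrite -[LHS]mulmx1 -(repKV s) mulKmx ?rep_unit. Qed.

Lemma facet_normal_tetra s i :
  (facet_normal s *m tetra i) 0 0 = weight (s^-1 i)%g.
Proof. by rewrite /facet_normal -mulmxA rep_tetra base_normal_tetra. Qed.

Lemma facet_normal_rep s r :
  facet_normal s *m tetra_rep r = facet_normal (s * r^-1)%g.
Proof. by rewrite /facet_normal -mulmxA repM invMg invgK. Qed.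

Lemma facet_normalE s x :
  (facet_normal s *m x) 0 0 = 4^-1 * \sum_i weight i * height x (s i).
Proof.
rewrite {1}[x]tetra_frame -scalemxAr mulmx_sumr mxE summxE; congr (_ * _).
rewrite [RHS](reindex_inj (@perm_inj _ (s^-1)%g)).
by apply: eq_bigr => i _; rewrite -scalemxAr mxE facet_normal_tetra permKV mulrC.
Qed.

Lemma rep_of_images (A : 'M[R]_3) (images : seq nat) s :
    (forall i : 'I_4, s i = inord (nth 0%N images i)) ->
    (forall i : 'I_4, A *m tetra i = tetra (inord (nth 0%N images i))) ->
  A = tetra_rep s.
Proof. by move=> sE AE; apply: eq_on_tetra => i; rewrite rep_tetra sE AE. Qed.

(** Each generator is the reflection that exchanges two vertices of the
    tetrahedron. *)
Lemma generators_rep :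
  [/\ R0 R = tetra_rep (tperm (inord 1) (inord 2)),
      R1 R = tetra_rep (tperm (inord 2) (inord 3)) &
      R2 R = tetra_rep (tperm (inord 0) (inord 3))].
Proof.
split; [ apply: (@rep_of_images _ [:: 0; 2; 1; 3]%N)
       | apply: (@rep_of_images _ [:: 0; 1; 3; 2]%N)
       | apply: (@rep_of_images _ [:: 3; 1; 2; 0]%N) ] => i;
  first [ by apply/val_inj; rewrite permE /= -!val_eqE /= !inordK //;
            case: i => [[|[|[|[|//]]]] ?] //=; rewrite ?inordK
        | apply/matrixP => k j; rewrite !mxE !big_ord_recl big_ord0 !mxE;
          by case: i k => [[|[|[|[|//]]]] ?] [[|[|[|//]]] ?];
            rewrite /= inordK //=; ring ].
Qed.

(** The three transpositions form a path 0 - 3 - 2 - 1, so that conjugation yields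
    all the transpositions through 3. *)
Lemma S4_generators (H : {group 'S_4}) :
  tperm (inord 1) (inord 2) \in H -> tperm (inord 2) (inord 3) \in H ->
  tperm (inord 0) (inord 3) \in H -> H = [set: 'S_4]%SET :> {set 'S_4}.
Proof.
move=> h12 h23 h03; apply/eqP; rewrite -finset.subTset -(gen_tperm (inord 3)) gen_subG.
apply/fintype.subsetP => _ /imsetP[j _ ->].
have -> : j = inord j by rewrite inord_val.
case: j => [[|[|[|[|//]]]] ?] /=.
- by rewrite tpermC.
- have -> : tperm (inord 3) (inord 1) =
      (tperm (inord 1) (inord 2) ^ tperm (inord 2) (inord 3))%g :> 'S_4.
    by rewrite tpermJ tpermL tpermD 1?tpermC // -(inj_eq val_inj) /= !inordK.
  by rewrite groupJ.
- by rewrite tpermC.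
- by rewrite tperm1 group1.
Qed.

Lemma TdE : Td R = [set tetra_rep s | s in [set: 'S_4]].
Proof.
have [R0_rep R1_rep R2_rep] := generators_rep; apply/seteqP; split.
  apply: smallest_sub => [|_ [[->|->]|->]].
  - split=> [|_ _ [s _ <-] [r _ <-]]; first by exists 1%g => //; rewrite rep1.
    by exists (r^-1 * s)%g => //; rewrite invmx_rep repM.
  - by exists (tperm (inord 1) (inord 2)) => //; rewrite R0_rep.
  - by exists (tperm (inord 2) (inord 3)) => //; rewrite R1_rep.
  - by exists (tperm (inord 0) (inord 3)) => //; rewrite R2_rep.
move=> _ [s _ <-] H [[H1 Hdiv] gensH].
have HV A : H A -> H (invmx A) by move=> HA; rewrite -[invmx A]mul1mx; apply: Hdiv.
have HM A B : H A -> H B -> H (A *m B).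
  by move=> HA HB; rewrite -[B]invmxK; apply/Hdiv/HV.
pose K := [set r : 'S_4 | `[< H (tetra_rep r) >]]%SET.
have K_group : group_set K.
  apply/group_setP; split=> [|r1 r2]; rewrite !inE; first by rewrite rep1.
  by move=> H1r H2r; rewrite -repM; apply: HM.
have KT : Group K_group = [set: 'S_4]%SET :> {set 'S_4}.
  by apply: S4_generators; rewrite !inE -?R0_rep -?R1_rep -?R2_rep; apply: gensH;
    rewrite /=; tauto.
have : s \in Group K_group by rewrite KT finset.in_setT.
by rewrite !inE.
Qed.

(** * The polyhedron as an intersection of half-spaces *)

Local Notation P := (tetrakis_hexahedron R).

Lemma signed_permE (e : 'I_3 -> bool) (p : 'S_3) x k :
  (diag_mx (\row_i (-1) ^+ e i) *m perm_mx p *m x) k 0 = (-1) ^+ e k * x (p k) 0.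
Proof. by rewrite -mulmxA mul_diag_mx -row_permE !mxE. Qed.

Lemma tetra_in_hull (b : bool) i : P (((-1) ^+ b * (2 / 3)) *: tetra i).
Proof.
apply: sub_gen_smallest; right.
pose e (k : 'I_3) := b (+) ~~ ((i == 0%N :> nat) || (i == k.+1 :> nat)).
exists (diag_mx (\row_k (-1) ^+ e k) *m perm_mx 1%g); first by exists 1%g, e.
apply/matrixP => k j; rewrite (ord1 j) signed_permE perm1 !mxE /e.
by rewrite signr_addb; case: k => [[|[|[|//]]] ?]; case: ifP => _ /=; ring.
Qed.

Lemma axis_in_hull (b : bool) (k : 'I_3) : P ((-1) ^+ b *: delta_mx k 0).
Proof.
apply: sub_gen_smallest; left.
exists (diag_mx (\row_k (-1) ^+ b) *m perm_mx (tperm 0 k)).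
  by exists (tperm 0 k), (fun=> b).
apply/matrixP => l j; rewrite (ord1 j) signed_permE !mxE eqxx andbT.
have -> : (l == k) = (tperm 0 k l == 0).
  by rewrite -[X in _ = (_ == X)](tpermR 0 k) (inj_eq (@perm_inj _ _)).
by case: (tperm 0 k l) => [[|[|[|//]]] ?].
Qed.

Lemma eq_entries (x y : 'cV[R]_3) : (forall k, x k 0 = y k 0) -> x = y.
Proof. by move=> exy; apply/matrixP => k j; rewrite (ord1 j). Qed.

Ltac by_entries :=
  by apply: eq_entries => -[[|[|[|//]]] ?]; rewrite !mxE /=; field.

(** The six edges of the tetrahedron are diagonals of the six faces of the cube, so
    their midpoints are the vertices of the octahedron. *)
Lemma tetra_midpoint i j : i != j -> exists (b : bool) (k : 'I_3),
  (1 / 2) *: (tetra i + tetra j) = (-1) ^+ b *: delta_mx k 0.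
Proof.
case: i j => [[|[|[|[|//]]]] ?] [[|[|[|[|//]]]] ?] //= _;
  first [ exists false, (Ordinal (isT : 0 < 3)%N); by_entries
        | exists false, (Ordinal (isT : 1 < 3)%N); by_entries
        | exists false, (Ordinal (isT : 2 < 3)%N); by_entries
        | exists true, (Ordinal (isT : 0 < 3)%N); by_entries
        | exists true, (Ordinal (isT : 1 < 3)%N); by_entries
        | exists true, (Ordinal (isT : 2 < 3)%N); by_entries ].
Qed.

Lemma axis_midpoint (b : bool) (k : 'I_3) : exists i j : 'I_4,
  i != j /\ (-1) ^+ b *: delta_mx k 0 = (1 / 2) *: (tetra i + tetra j).
Proof.
have pair (m n : nat) (ltm : (m < 4)%N) (ltn : (n < 4)%N) : m != n ->
    (-1) ^+ b *: delta_mx k 0 =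
      (1 / 2) *: (tetra (Ordinal ltm) + tetra (Ordinal ltn)) ->
  exists i j : 'I_4,
    i != j /\ (-1) ^+ b *: delta_mx k 0 = (1 / 2) *: (tetra i + tetra j).
  by exists (Ordinal ltm), (Ordinal ltn).
case: b k pair => -[[|[|[|//]]] ?] pair;
  [ apply: (pair 2 3 isT isT)%N | apply: (pair 1 3 isT isT)%N
  | apply: (pair 1 2 isT isT)%N | apply: (pair 0 1 isT isT)%N
  | apply: (pair 0 2 isT isT)%N | apply: (pair 0 3 isT isT)%N ] => //; by_entries.
Qed.

(** The tetrahedron and its opposite share out the eight vertices of the cube,
    according to the parity of the number of minus signs. *)
Lemma sign_vector_tetra (e : 'I_3 -> bool) : exists (b : bool) (i : 'I_4),
  \col_k (-1) ^+ e k = (-1) ^+ b *: tetra i.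
Proof.
have pick (b : bool) (m : nat) (ltm : (m < 4)%N) :
    \col_k (-1) ^+ e k = (-1) ^+ b *: tetra (Ordinal ltm) ->
  exists (b : bool) (i : 'I_4), \col_k (-1) ^+ e k = (-1) ^+ b *: tetra i.
  by exists b, (Ordinal ltm).
case e0: (e ord0); case e1: (e (lift ord0 ord0));
  case e2: (e (lift ord0 (lift ord0 ord0)));
  [ apply: (pick true 0%N isT) | apply: (pick false 3%N isT)
  | apply: (pick false 2%N isT) | apply: (pick true 1%N isT)
  | apply: (pick false 1%N isT) | apply: (pick true 2%N isT)
  | apply: (pick true 3%N isT) | apply: (pick false 0%N isT) ];
  by apply: eq_entries => k; rewrite !mxE; have [->|[->|->]] := ord3_cases k;
    rewrite ?e0 ?e1 ?e2 /=; ring.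
Qed.

Lemma weight_bound (b : bool) i : (-1) ^+ b * (2 / 3) * weight i <= 1.
Proof. by case: i b => [[|[|[|[|//]]]] ?] []; rewrite /weight /=; lra. Qed.

Lemma weight_pair i j : i != j -> 1 / 2 * (weight i + weight j) <= 1.
Proof.
by case: i j => [[|[|[|[|//]]]] ?] [[|[|[|[|//]]]] ?] //= _; rewrite /weight /=; lra.
Qed.

Lemma hull_conv (t : R) x y : 0 <= t -> t <= 1 -> P x -> P y ->
  P (t *: x + (1 - t) *: y).
Proof.
move=> t0 t1 Px Py C CP; have [convC _] := CP.
have := convC x y (Itv01 t0 t1); rewrite !inE; apply; [exact: Px | exact: Py].
Qed.

Lemma hull0 : P 0.
Proof.
rewrite (_ : 0 = 1 / 2 *: (((-1) ^+ false * (2 / 3)) *: tetra ord0)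
  + (1 - 1 / 2) *: (((-1) ^+ true * (2 / 3)) *: tetra ord0)).
  by apply: hull_conv; [lra | lra | apply: tetra_in_hull | apply: tetra_in_hull].
by rewrite !scalerA -scalerDl -[LHS](scale0r (tetra ord0)) /=; congr (_ *: _); field.
Qed.

Lemma hull_comb2 (a b : R) x y : 0 <= a -> 0 <= b -> a + b <= 1 ->
  P x -> P y -> P (a *: x + b *: y).
Proof.
move=> a0 b0 ab1 Px Py; have [ab0|ab_neq0] := eqVneq (a + b) 0.
  have [-> ->] : a = 0 /\ b = 0 by lra.
  by rewrite !scale0r addr0; apply: hull0.
have ab_gt0 : 0 < a + b by rewrite lt_neqAle eq_sym ab_neq0 addr_ge0.
have Pz : P (a / (a + b) *: x + (1 - a / (a + b)) *: y).
  apply: hull_conv => //; first by rewrite divr_ge0 // addr_ge0.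
  by rewrite ler_pdivrMr // mul1r lerDl.
have := hull_conv (addr_ge0 a0 b0) ab1 Pz hull0.
rewrite scaler0 addr0 scalerDr !scalerA mulrBr mulr1 mulrC divfK //.
by rewrite [a + b]addrC addrK.
Qed.

Lemma hull_comb3 (a b c : R) x y z : 0 <= a -> 0 <= b -> 0 <= c -> a + b + c <= 1 ->
  P x -> P y -> P z -> P (a *: x + b *: y + c *: z).
Proof.
move=> a0 b0 c0 abc1 Px Py Pz; have [ab0|ab_neq0] := eqVneq (a + b) 0.
  have [-> ->] : a = 0 /\ b = 0 by lra.
  by rewrite scale0r add0r; apply: hull_comb2 => //; lra.
have ab_gt0 : 0 < a + b by rewrite lt_neqAle eq_sym ab_neq0 addr_ge0.
have Pw : P (a / (a + b) *: x + b / (a + b) *: y).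
  apply: hull_comb2; rewrite ?divr_ge0 ?addr_ge0 //.
  by rewrite -mulrDl divff.
have := hull_comb2 (addr_ge0 a0 b0) c0 abc1 Pw Pz.
by rewrite scalerDr !scalerA ![(a + b) * _]mulrC !divfK.
Qed.

Lemma eval_comb (u : 'rV[R]_3) (a b : R) x y :
  (u *m (a *: x + b *: y)) 0 0 = a * (u *m x) 0 0 + b * (u *m y) 0 0.
Proof. by rewrite mulmxDr -!scalemxAr !mxE. Qed.

(** The fourteen generating points are the vertices of the tetrahedron times 2/3 or
    - 2/3 and the midpoints of its edges.  As a facet normal takes the four weights
    at the vertices, the bound is weight_bound or weight_pair. *)
Lemma hull_facet_normal x s : P x -> (facet_normal s *m x) 0 0 <= 1.
Proof.
suff sub : P `<=` [set x | forall s, (facet_normal s *m x) 0 0 <= 1].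
  by move=> /sub; apply.
move=> {x s}; apply: smallest_sub.
  move=> x y t; rewrite !inE /= => hx hy s.
  rewrite (_ : conv t x y = t%:num *: x + (1 - t%:num) *: y) // eval_comb.
  move: (hx s) (hy s).
  have : 0 <= t%:num by []. have : t%:num <= 1 by [].
  move: (_ 0 0) (_ 0 0) t%:num => u v t' *; nra.
move=> x [[_ [p [e ->]] <-]|[_ [p [e ->]] <-]] s.
  have -> : diag_mx (\row_i (-1) ^+ e i) *m perm_mx p *m vec3 1 0 0 =
      (-1) ^+ e (p^-1 0)%g *: delta_mx (p^-1 0)%g 0 :> 'cV[R]_3.
    apply/matrixP => k j; rewrite (ord1 j) signed_permE !mxE eqxx andbT.
    have [->|ne] := eqVneq k (p^-1 0)%g; first by rewrite permKV.
    have : p k != 0 by apply: contraNneq ne => <-; rewrite permK.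
    by case: (p k) => [[|[|[|//]]] ?]; rewrite ?mulr0.
  have [i [j [ij ->]]] := axis_midpoint (e (p^-1 0)%g) (p^-1 0)%g.
  rewrite scalerDr eval_comb !facet_normal_tetra -mulrDr weight_pair //.
  by rewrite (inj_eq (@perm_inj _ _)).
have -> : diag_mx (\row_i (-1) ^+ e i) *m perm_mx p *m (2 / 3 *: vec3 1 1 1) =
    (2 / 3) *: \col_k (-1) ^+ e k :> 'cV[R]_3.
  apply/matrixP => k j; rewrite (ord1 j) signed_permE !mxE.
  by case: (p k) => [[|[|[|//]]] ?]; rewrite /= mulr1 mulrC.
have [b [i ->]] := sign_vector_tetra e.
rewrite scalerA [_ * (-1) ^+ b]mulrC -scalemxAr mxE facet_normal_tetra.
exact: weight_bound.
Qed.

Lemma weight_decreasing (i j : 'I_4) : (i < j)%N -> weight j < weight i.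
Proof.
by case: i j => [[|[|[|[|//]]]] ?] [[|[|[|[|//]]]] ?] //= _; rewrite /weight /=; lra.
Qed.

(** The rearrangement inequality, read backwards: a permutation that maximises the
    weighted sum sorts y, since the weights decrease strictly and swapping two
    entries that are out of order would increase the sum. *)
Lemma sorting_perm (y : 'I_4 -> R) : exists s : 'S_4,
  forall i j : 'I_4, (i <= j)%N -> y (s j) <= y (s i).
Proof.
pose total r := \sum_i weight i * y (r i).
have [s _ smax] := @arg_maxP _ _ _ 1%g xpredT total isT.
exists s => i j; rewrite leq_eqVlt => /predU1P[/val_inj->//|ltij].
have nij : j != i by rewrite -(inj_eq val_inj) gtn_eqF.
have splitT r : total r = weight i * y (r i) + (weight j * y (r j) +
    \sum_(k | (k != i) && (k != j)) weight k * y (r k)).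
  by rewrite /total (bigD1 i) //= (bigD1 j).
have : total (tperm i j * s)%g <= total s := smax _ isT.
rewrite !splitT !permM tpermL tpermR.
rewrite [X in _ + (_ + X) <= _](eq_bigr (fun k => weight k * y (s k))); last first.
  by move=> k /andP[ki kj]; rewrite permM tpermD // eq_sym.
have := weight_decreasing ltij.
move: (\sum_(_ | _) _) (weight i) (weight j) => S a b lt_ba le_sum.
have : 0 <= (a - b) * (y (s i) - y (s j)) by lra.
by rewrite pmulr_rge0 ?subr_ge0 // subr_gt0.
Qed.

(** For the direction from right to left: when the heights z0 >= z1 >= z2 >= z3 of x
    are sorted by s, x is the combination of three vertices of the facet s with
    the coefficients 3/8 (z0 - z1), 1/2 (z1 - z2), 3/8 (z2 - z3), whose sum is the
    value of the facet normal at x. *)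
Lemma hullP x : P x <-> forall s, (facet_normal s *m x) 0 0 <= 1.
Proof.
split=> [Px s|Hx]; first exact: hull_facet_normal.
have [s sorted_s] := sorting_perm (height x).
have := Hx s; rewrite facet_normalE => le1.
pose o1 : 'I_4 := lift ord0 ord0; pose o2 : 'I_4 := lift ord0 (lift ord0 ord0).
pose o3 : 'I_4 := lift ord0 (lift ord0 (lift ord0 ord0)).
have le10 := sorted_s ord0 o1 isT; have le21 := sorted_s o1 o2 isT.
have le32 := sorted_s o2 o3 isT.
have sum_height : \sum_i height x i = 0.
  rewrite -[RHS](_ : ((\sum_i tetra i)^T *m x) 0 0 = 0); last first.
    by rewrite sum_tetra trmx0 mul0mx mxE.
  by rewrite linear_sum mulmx_suml summxE.
have sum_s : \sum_i height x (s i) = 0.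
  by rewrite -[RHS]sum_height [RHS](reindex_inj (@perm_inj _ s)).
have sum_v : \sum_i tetra (s i) = 0.
  by rewrite -[RHS]sum_tetra [RHS](reindex_inj (@perm_inj _ s)).
have frame_s : x = 4^-1 *: \sum_i height x (s i) *: tetra (s i).
  by rewrite {1}[x]tetra_frame [in LHS](reindex_inj (@perm_inj _ s)).
have -> : x = (3 / 8 * (height x (s ord0) - height x (s o1))) *:
        (((-1) ^+ false * (2 / 3)) *: tetra (s ord0))
    + (1 / 2 * (height x (s o1) - height x (s o2))) *:
        ((1 / 2) *: (tetra (s ord0) + tetra (s o1)))
    + (3 / 8 * (height x (s o2) - height x (s o3))) *:
        (((-1) ^+ true * (2 / 3)) *: tetra (s o3)).
  rewrite {1}frame_s; apply/matrixP => k j.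
  move/matrixP/(_ k j): sum_v; move: sum_height sum_s => _.
  rewrite !big_ord_recl !big_ord0 -/o1 -/o2 -/o3 !addr0.
  move: (height x (s ord0)) (height x (s o1)) (height x (s o2)) (height x (s o3)).
  move: (tetra (s ord0)) (tetra (s o1)) (tetra (s o2)) (tetra (s o3)).
  move=> w0 w1 w2 w3 z0 z1 z2 z3; rewrite !mxE => sum_z sum_w.
  have -> : w2 k j = - (w0 k j + w1 k j + w3 k j) by lra.
  have -> : z2 = - (z0 + z1 + z3) by lra.
  by rewrite /=; field.
rewrite !big_ord_recl !big_ord0 -/o1 -/o2 -/o3 !addr0 /weight /= in le1.
apply: hull_comb3; try exact: tetra_in_hull; try lra.
have [|b [k ->]] := @tetra_midpoint (s ord0) (s o1); last exact: axis_in_hull.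
by rewrite (inj_eq (@perm_inj _ _)).
Qed.

(** * The faces are the 24 facets *)

Definition facet s : set 'cV[R]_3 :=
  [set x | P x /\ (facet_normal s *m x) 0 0 = 1].

Lemma hull_rep s x : P x -> P (tetra_rep s *m x).
Proof.
by move=> /hullP Hx; apply/hullP => r; rewrite mulmxA facet_normal_rep.
Qed.

Lemma facet_rep s r x : facet s x -> facet (s * r)%g (tetra_rep r *m x).
Proof.
move=> [Px nx]; split; first exact: hull_rep.
by rewrite mulmxA facet_normal_rep mulgK.
Qed.

Lemma mximage_facet s r : mximage (tetra_rep r) (facet s) = facet (s * r)%g.
Proof.
apply/seteqP; split=> [_ [x Fx <-]|x Fx]; first exact: facet_rep.
exists (tetra_rep r^-1 *m x); last by rewrite mulmxA repKV mul1mx.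
by rewrite -[s](mulgK r); apply: facet_rep.
Qed.

(** The three vertices of the facet s; corners a and c carry an explicit sign in
    order to have the form of tetra_in_hull. *)
Definition corner_a s : 'cV[R]_3 := ((-1) ^+ false * (2 / 3)) *: tetra (s ord0).
Definition corner_b s : 'cV[R]_3 :=
  (1 / 2) *: (tetra (s ord0) + tetra (s (inord 1))).
Definition corner_c s : 'cV[R]_3 :=
  ((-1) ^+ true * (2 / 3)) *: tetra (s (inord 3)).

Lemma facet_corners s :
  [/\ facet s (corner_a s), facet s (corner_b s) & facet s (corner_c s)].
Proof.
split; split.
- exact: tetra_in_hull.
- by rewrite -scalemxAr mxE facet_normal_tetra permK /weight /=; field.
- rewrite /corner_b.
  have [|b [k ->]] := @tetra_midpoint (s ord0) (s (inord 1)); last exact: axis_in_hull.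
  by rewrite (inj_eq (@perm_inj _ _)) -(inj_eq val_inj) /= inordK.
- rewrite /corner_b scalerDr eval_comb !facet_normal_tetra !permK /weight /= inordK //=.
  by field.
- exact: tetra_in_hull.
- by rewrite -scalemxAr mxE facet_normal_tetra permK /weight /= inordK //=; field.
Qed.

Lemma corners_rep s :
  [/\ corner_a s = tetra_rep s *m corner_a 1, corner_b s = tetra_rep s *m corner_b 1
    & corner_c s = tetra_rep s *m corner_c 1].
Proof. by split; rewrite -scalemxAr ?mulmxDr !rep_tetra !perm1. Qed.

Lemma corners_aff_indep s : aff_indep3 (corner_a s) (corner_b s) (corner_c s).
Proof.
have [-> -> ->] := corners_rep s.
rewrite /aff_indep3 -!mulmxBr -mul_mx_row eqmxMfull ?row_full_unit ?rep_unit //.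
apply/eqP; rewrite eqn_leq rank_leq_col /=.
(* The rows k1 and k2 form a left inverse of the 3 x 2 matrix of the base facet. *)
pose k1 : 'rV[R]_3 := \row_k [:: 3; 0; 0]`_k.
pose k2 : 'rV[R]_3 := \row_k [:: 0; 3 / 4; - (3 / 4)]`_k.
have rank_inv : \rank (col_mx k1 k2 *m row_mx (corner_b 1 - corner_a 1)
    (corner_c 1 - corner_a 1)) = 2%N.
  rewrite mul_col_row -[RHS](mxrank1 R 2) (scalar_mx_block 1 1);
  congr (\rank (block_mx _ _ _ _));
  apply/matrixP => i j; rewrite (ord1 i) (ord1 j) !mxE !big_ord_recl big_ord0 !mxE;
  by rewrite !perm1 /= ?inordK //=; field.
rewrite -[X in (X <= _)%N]rank_inv; exact: mxrankM_maxr.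
Qed.

Lemma facet_face s : faces P (facet s).
Proof.
have [Fa Fb Fc] := facet_corners s.
exists (facet_normal s), 1; split=> //.
- apply/eqP => n0; have [_] := Fa; rewrite n0 mul0mx mxE => /eqP.
  by rewrite eq_sym oner_eq0.
- by move=> x /hullP/(_ s).
- exists (corner_a s), (corner_b s), (corner_c s); split=> //.
  exact: corners_aff_indep.
Qed.

Lemma weight_inj : injective weight.
Proof.
move=> i j eij; case: (ltngtP i j) => [lt_ij|lt_ji|/val_inj//].
  by have := weight_decreasing lt_ij; rewrite eij ltxx.
by have := weight_decreasing lt_ji; rewrite eij ltxx.
Qed.

(** The action on the facets is free: as the weights are distinct, the value 1 of the
    facet normal of r at the three corners of the facet s forces s * r^-1 to fix 0, 1
    and 3, hence also 2. *)
Lemma facet_inj : injective facet.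
Proof.
move=> s r esr; have [Fa Fb Fc] := facet_corners s; rewrite esr in Fa Fb Fc.
pose q := (s * r^-1)%g.
have qa : weight (q ord0) = 3 / 2.
  case: Fa => _; rewrite -scalemxAr mxE facet_normal_tetra -permM -/q /=; lra.
have qb : weight (q ord0) + weight (q (inord 1)) = 2.
  case: Fb => _; rewrite /corner_b scalerDr eval_comb !facet_normal_tetra -!permM.
  by rewrite -/q; lra.
have qc : weight (q (inord 3)) = - (3 / 2).
  case: Fc => _; rewrite -scalemxAr mxE facet_normal_tetra -permM -/q /=; lra.
have q0 : q ord0 = ord0 by apply: weight_inj; rewrite qa.
have q1 : q (inord 1) = inord 1.
  by apply: weight_inj; rewrite {2}/weight /= inordK //=; lra.
have q3 : q (inord 3) = inord 3 by apply: weight_inj; rewrite qc /weight /= inordK.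
have fix_q i : i != inord 2 -> q i = i.
  have ordE (k : 'I_4) (m : nat) : (m < 4)%N -> val k = m -> k = inord m.
    by move=> ltm4 km; apply: val_inj; rewrite /= inordK.
  case e: (val i) => [|[|[|[|m]]]] => [|||_|];
    last by have := ltn_ord i; rewrite -[X in (X < _)%N]/(val i) e.
  - by have -> : i = ord0 by apply: val_inj.
  - by rewrite [i](ordE i 1%N isT e).
  - by rewrite [i](ordE i 2%N isT e) eqxx.
  - by rewrite [i](ordE i 3%N isT e).
suff q_id : q = 1%g by rewrite -[s](mulgKV r) -/q q_id mul1g.
apply/permP => i; rewrite perm1; apply/eqP/negPn/negP => qi.
have qi2 : q i != inord 2.
  apply: contraNneq qi => qi2.
  by have [i2|/fix_q->//] := eqVneq i (inord 2); rewrite qi2 i2.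
by have /perm_inj qii := fix_q _ qi2; rewrite qii eqxx in qi.
Qed.

(** A nonzero functional is maximal on P only at points of facets: from a point that
    lies strictly inside all half-spaces, a small step along u stays in P. *)
Lemma ascent (u : 'rV[R]_3) x : u != 0 ->
    (forall s, (facet_normal s *m x) 0 0 < 1) ->
  exists2 y, P y & (u *m x) 0 0 < (u *m y) 0 0.
Proof.
move=> u0 Hx.
have uu : 0 < (u *m u^T) 0 0.
  rewrite lt_neqAle mxE sumr_ge0 ?andbT => [|k _]; last by rewrite mxE -expr2 sqr_ge0.
  apply: contra u0 => /eqP/esym/psumr_eq0P h; apply/eqP/matrixP => i j.
  have /eqP := h (fun k _ => ltac:(rewrite mxE -expr2 sqr_ge0; exact isT)) j isT.
  by rewrite (ord1 i) !mxE mulf_eq0 orbb => /eqP.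
have [s0 _ max0] :=
  @arg_maxP _ _ _ 1%g xpredT (fun s => (facet_normal s *m x) 0 0) isT.
(* The step e is the least slack divided by a bound K on all the slopes along u. *)
pose K := 1 + \sum_s `|(facet_normal s *m u^T) 0 0|.
have K_gt0 : 0 < K by rewrite ltr_pwDl ?sumr_ge0.
pose e := (1 - (facet_normal s0 *m x) 0 0) / K.
have e_gt0 : 0 < e by rewrite divr_gt0 // subr_gt0.
exists (1 *: x + e *: u^T); last by rewrite eval_comb mul1r ltrDl mulr_gt0.
apply/hullP => s; rewrite eval_comb mul1r.
have le_s0 : (facet_normal s *m x) 0 0 <= (facet_normal s0 *m x) 0 0 := max0 s isT.
have leK : (facet_normal s *m u^T) 0 0 <= K.
  apply: le_trans (ler_norm _) _; rewrite /K (bigD1 s) //= addrCA lerDl.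
  by rewrite addr_ge0 ?sumr_ge0.
have : e * (facet_normal s *m u^T) 0 0 <= e * K by rewrite ler_pM2l.
by rewrite {2}/e divfK ?gt_eqF //; lra.
Qed.

Lemma facesE : faces P = [set facet s | s in [set: 'S_4]].
Proof.
apply/seteqP; split=> [F|_ [s _ <-]]; last exact: facet_face.
move=> [u [c [u0 le_c defF [x [y [z [Fx Fy Fz indep]]]]]]].
move: Fx Fy Fz; rewrite defF => -[Px ux] [Py uy] [Pz uz].
(* m is the centroid of x, y and z, written as an iterated eval_comb. *)
pose m := 1 *: (1 / 3 *: x + 1 / 3 *: y) + 1 / 3 *: z.
have evm (w : 'rV[R]_3) : (w *m m) 0 0 =
    1 / 3 * ((w *m x) 0 0 + (w *m y) 0 0 + (w *m z) 0 0).
  by rewrite /m !eval_comb; ring.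
have [s ns_m] : exists s, 1 <= (facet_normal s *m m) 0 0.
  apply: contrapT => no_s.
  have lt1 s : (facet_normal s *m m) 0 0 < 1.
    by rewrite ltNge; apply/negP => ge1; apply: no_s; exists s.
  have [y' Py'] := ascent u0 lt1; rewrite evm ux uy uz.
  by have := le_c y' Py'; lra.
have := (hull_facet_normal s Px, hull_facet_normal s Py, hull_facet_normal s Pz).
move: ns_m; rewrite evm => ns_m [[nx ny] nz].
have {nx ny nz ns_m} [nx ny nz] : [/\ (facet_normal s *m x) 0 0 = 1,
    (facet_normal s *m y) 0 0 = 1 & (facet_normal s *m z) 0 0 = 1].
  by split; lra.
exists s => //.
(* Both u and the facet normal lie in the one-dimensional left kernel of the matrix
   of differences, so they are proportional. *)
have kill (w : 'rV[R]_3) d : (w *m x) 0 0 = d -> (w *m y) 0 0 = d ->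
    (w *m z) 0 0 = d -> (w <= kermx (row_mx (y - x) (z - x)))%MS.
  move=> wx wy wz; apply/sub_kermxP; rewrite mul_mx_row -[0]row_mx0; congr row_mx;
  by rewrite mulmxBr [w *m _]mx11_scalar [w *m x]mx11_scalar ?wx ?wy ?wz subrr.
have n0 : facet_normal s != 0.
  by apply: contra_eqN nx => /eqP->; rewrite mul0mx mxE eq_sym oner_eq0.
have : (u <= facet_normal s)%MS.
  apply: submx_trans (kill u c ux uy uz) _.
  rewrite -(geq_leqif (mxrank_leqif_sup (kill _ 1 nx ny nz))).
  by rewrite mxrank_ker indep rank_rV n0.
case/sub_rVP=> l def_u.
have def_c : c = l by rewrite -ux def_u -scalemxAl mxE nx mulr1.
have l0 : l != 0 by apply: contraNneq u0 => l0; rewrite def_u l0 scale0r.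
apply/seteqP; split=> v [Pv ev]; split=> //.
  by rewrite def_u -scalemxAl mxE ev mulr1.
by move: ev; rewrite def_u -scalemxAl mxE def_c => /(canRL (mulKf l0)); rewrite mulVf.
Qed.

(** * Tilings as colourings of S_4 *)

Variable T : tile_designs (Td R) P.

Definition face_of s : face P := exist _ (facet s) (mem_set (facet_face s)).

Lemma face_ofP (F : face P) : exists s, F = face_of s.
Proof.
have : faces P (val F) by apply/set_mem/(valP F).
have facesP X : faces P X -> exists s, X = facet s.
  by rewrite facesE => -[s _ <-]; exists s.
by case/facesP => s defF; exists s; apply: val_inj; rewrite /= defF.
Qed.

Lemma face_of_inj : injective face_of.
Proof. by move=> s r /(congr1 val) /= /facet_inj. Qed.

Definition act s (d : tile T * face P) := tile_act (tetra_rep s) d.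

Lemma Td_rep s : Td R (tetra_rep s).
Proof. by rewrite TdE; exists s. Qed.

Lemma Td_repP A : Td R A -> exists s, A = tetra_rep s.
Proof. by rewrite TdE => -[s _ <-]; exists s. Qed.

Lemma actM s r d : act s (act r d) = act (r * s)%g d.
Proof. by rewrite /act -repM (tile_actM (Td_rep s) (Td_rep r)). Qed.

Lemma act1 d : act 1%g d = d.
Proof. by rewrite /act rep1 tile_act1. Qed.

Lemma act_face s r a : (act s (a, face_of r)).2 = face_of (r * s)%g.
Proof.
by apply: val_inj; rewrite /= -mximage_facet; apply: (tile_act_face (Td_rep s)).
Qed.

(** The graph of the tiling that arises by transporting the design f s on the base
    face to the face of s.  Because it is transported by the designs' own action,
    the twisting of the designs by the group disappears from the parameter f. *)
Definition unrolled (f : {ffun 'S_4 -> tile T}) : set (tile T * face P) :=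
  [set act s (f s, face_of 1%g) | s in [set: 'S_4]].

(** The face of act s (f s, face_of 1) determines s, and the design determines f s
    because act s is invertible. *)
Lemma unrolled_inj : injective unrolled.
Proof.
move=> f g efg; apply/ffunP => s.
have : unrolled g (act s (f s, face_of 1%g)) by rewrite -efg; exists s.
case=> r _ e; have := congr1 snd e; rewrite !act_face !mul1g => /face_of_inj ers.
move: e; rewrite ers => /(congr1 (act s^-1%g)); rewrite !actM mulgV !act1.
by case.
Qed.

Lemma graph_unrolled (tau : tiling T) : exists f, tiling_graph tau = unrolled f.
Proof.
pose f := [ffun s : 'S_4 => (act s^-1%g (tau (face_of s), face_of s)).1].
have fE s : act s (f s, face_of 1%g) = (tau (face_of s), face_of s).
  have -> : (f s, face_of 1%g) = act s^-1%g (tau (face_of s), face_of s).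
    rewrite ffunE -(mulgV s) -(act_face s^-1%g s (tau (face_of s))).
    by rewrite -surjective_pairing.
  by rewrite actM mulVg act1.
exists f; apply/seteqP; split=> [_ [F _ <-]|_ [s _ <-]].
  by have [s ->] := face_ofP F; exists s.
by rewrite fE; exists (face_of s).
Qed.

Lemma unrolled_graph f : exists tau : tiling T, tiling_graph tau = unrolled f.
Proof.
have [tau tauE] : exists tau : tiling T,
    forall s, act s (f s, face_of 1%g) = (tau (face_of s), face_of s).
  pose num F := projT1 (cid (face_ofP F)).
  have numK s : num (face_of s) = s.
    by apply: face_of_inj; rewrite -(projT2 (cid (face_ofP (face_of s)))).
  exists (fun F => (act (num F) (f (num F), face_of 1%g)).1) => s.
  have := act_face s 1%g (f s); rewrite mul1g numK.
  by case: (act s _) => a F /= ->.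
exists tau; apply/seteqP; split=> [_ [F _ <-]|_ [s _ <-]].
  by have [s ->] := face_ofP F; exists s.
by rewrite tauE; exists (face_of s).
Qed.

(** The map act s takes the transport of f r, over the face of r, to the transport of
    the same f r over the face of r * s. *)
Lemma act_unrolled s f :
  [set act s d | d in unrolled f] = unrolled (translate f s).
Proof.
apply/seteqP; split=> [_ [_ [r _ <-] <-]|_ [r _ <-]].
  by exists (r * s)%g => //; rewrite ffunE mulgK actM.
exists (act (r * s^-1)%g (f (r * s^-1)%g, face_of 1%g)).
  by exists (r * s^-1)%g.
by rewrite actM mulgKV ffunE.
Qed.

Definition tilings_of (O : {set {ffun 'S_4 -> tile T}}) : set (tiling T) :=
  [set tau | exists2 f, f \in O & tiling_graph tau = unrolled f].

(** Every colouring f is the unrolling of some tiling, so a set of colourings can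
    be recovered from its set of tilings. *)
Lemma tilings_of_inj : injective tilings_of.
Proof.
have sub O1 O2 : tilings_of O1 = tilings_of O2 -> {subset O1 <= O2}.
  move=> e f fO1; have [tau tauf] := unrolled_graph f.
  have : tilings_of O2 tau by rewrite -e; exists f.
  by case=> g gO2; rewrite tauf => /unrolled_inj ->.
by move=> O1 O2 e; apply/setP => f; apply/idP/idP; apply: sub.
Qed.

Lemma tiling_orbitE (tau : tiling T) f : tiling_graph tau = unrolled f ->
  tiling_orbit tau = tilings_of (orbit (translation _ _) [set: 'S_4]%SET f).
Proof.
move=> tauf; apply/seteqP; split=> tau'.
  rewrite /tiling_orbit /= tauf => -[_ /Td_repP[s ->] graph'].
  by exists (translate f s); [apply: mem_orbit; rewrite inE |
    rewrite graph'; apply: act_unrolled].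
case=> _ /orbitP[s _ <-] graph'; exists (tetra_rep s); first exact: Td_rep.
by rewrite graph' tauf -act_unrolled.
Qed.

Lemma card_tiling_orbits :
  (tiling_orbits T #= `I_#|orbit (translation _ _) [set: 'S_4]%SET @:
                             [set: {ffun 'S_4 -> tile T}]%SET|)%card.
Proof.
apply: card_eq_trans _ (card_eq_finset _).
set X := _ @: _; have -> : tiling_orbits T = [set tilings_of O | O in [set` X]].
  apply/seteqP; split=> [_ [tau _ <-]|_ [_ /imsetP[f _ ->] <-]].
    have [f tauf] := graph_unrolled tau; rewrite (tiling_orbitE tauf).
    exists (orbit (translation _ _) [set: 'S_4]%SET f) => //.
    by apply: imset_f; rewrite inE.
  by have [tau tauf] := unrolled_graph f; exists tau; rewrite ?(tiling_orbitE tauf).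
by apply: inj_card_eq => O1 O2 _ _; apply: tilings_of_inj.
Qed.

End Geometry.

Theorem theorem9 (R : realType)
    (T : tile_designs (Td R) (tetrakis_hexahedron R))
    (t : nat) (ht : #|tile T| = t) :
  exists N : nat,
    [/\ (tiling_orbits T #= `I_N)%card,
        N%:R = 1 / 24 * (t%:R ^+ 24 + 3 * t%:R ^+ 12 + 8 * t%:R ^+ 8
                         + 6 * t%:R ^+ 12 + 6 * t%:R ^+ 6) :> rat &
        1 / 24 * (t%:R ^+ 24 + 3 * t%:R ^+ 12 + 8 * t%:R ^+ 8
                  + 6 * t%:R ^+ 12 + 6 * t%:R ^+ 6)
        = 1 / 24 * (t%:R ^+ 24 + 9 * t%:R ^+ 12 + 8 * t%:R ^+ 8
                    + 6 * t%:R ^+ 6) :> rat].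
Proof.
eexists; split; [exact: card_tiling_orbits | | by ring].
set N := #|_|.
have count : (N * 24 = t ^ 24 + 9 * t ^ 12 + 8 * t ^ 8 + 6 * t ^ 6)%N.
  have := card_orbits_translation ('S_4 : finGroupType) (tile T).
  by rewrite card_Sn -[4`!]/24%N ht sum_orders_S4.
have {}count : N%:R * 24 = t%:R ^+ 24 + 9 * t%:R ^+ 12 + 8 * t%:R ^+ 8
    + 6 * t%:R ^+ 6 :> rat.
  by rewrite -!natrX -!natrM -!natrD -count.
by rewrite -[LHS](mulfK (_ : 24 != 0 :> rat)) // count; field.
Qed.
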